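(* Let $u\in\mathcal X$ be the solution of the linear coercive problem $a(u,v)=f(v)$ for all $v\in\mathcal X$, let $\mathcal Z_0$ be an arbitrary initial reduced space, and let $\{\widehat u_\ell\}_{\ell=1,2,\ldots}$ (with initial element $\widehat u_0$ associated with $\mathcal Z_0$) be the sequence of Galerkin (partition-of-unity) reduced solutions generated by the greedy enrichment procedure described in the context. Then, for every $\ell=1,2,\ldots$, $$\|u-\widehat u_\ell\|_a\ \le\ \Big(1-\frac{1}{N_{\rm dd}\,c_{\rm pu}^2}\Big)^{\ell/2}\ \|u-\widehat u_0\|_a .$$
   Context: Problem. $\Omega\subset\mathbb R^d$ is a domain, $\mathcal X$ is a Hilbert space with $H^1_0(\Omega)\subset\mathcal X\subset H^1(\Omega)$, $a:\mathcal X\times\mathcal X\to\mathbb R$ is a coercive bilinear form and $f\in\mathcal X'$. Set $\mathcal G(w,v)=f(v)-a(w,v)$; thus $u\in\mathcal X$ satisfies $\mathcal G(u,v)=0$ for all $v\in\mathcal X$. A single, fixed parameter configuration is considered (the training set consists of one parameter value), and dependence on the parameter is omitted. The energy norm is $\|w\|_a=\sqrt{a(w,w)}$ for $w\in\mathcal X$ and the dual norm is $\|F\|_{\mathcal X'}=\sup_{v\in\mathcal X}F(v)/\|v\|_a$ for $F\in\mathcal X'$ (suprema of quotients are over nonzero $v$). Partition. $\{\omega_i\}_{i=1}^{N_{\rm dd}}$ is an overlapping cover of $\Omega$. There is a single archetype component $\widehat\Omega$, with mappings $\Phi_i:\widehat\Omega\to\omega_i$ that are compositions of a translation and a rotation,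 and $\{\phi_i\}_{i=1}^{N_{\rm dd}}$ is a partition of unity with ${\rm supp}(\phi_i)\subset\overline{\omega_i}$, $0\le\phi_i\le1$, $\|\nabla\phi_i\|_{L^\infty(\Omega)}\le C_i$ for constants $C_i$, and $\sum_i\phi_i=1$ on $\Omega$. The local spaces are $\mathcal X_{i,0}=H^1_0(\omega_i)$, whose elements are extended by zero outside $\omega_i$ and regarded as elements of $\mathcal X$. Local residuals. For $w\in\mathcal X$, $$r^{(i)}[w]=\sup_{v\in\mathcal X_{i,0}}\frac{\mathcal G(w,v)}{\|v\|_a},\qquad i=1,\dots,N_{\rm dd}.$$ The constant $c_{\rm pu}>0$ is such that $\|\mathcal G(w,\cdot)\|_{\mathcal X'}\le c_{\rm pu}\big(\sum_{i=1}^{N_{\rm dd}}(r^{(i)}[w])^2\big)^{1/2}$ for all $w\in\mathcal X$. Reduced space and Galerkin solution. To a finite-dimensional space $\mathcal Z$ of functions on $\widehat\Omega$ one associates the global space $$\mathcal Z_{\rm gfem}=\Big\{\sum_{i=1}^{N_{\rm dd}}\phi_i\,(\zeta_i\circ\Phi_i^{-1}):\ \zeta_i\in\mathcal Z\Big\}\subset\mathcal X .$$ The reduced solution associated with $\mathcal Z$ is the $\widehat u\in\mathcal Z_{\rm gfem}$ such that $\mathcal G(\widehat u,v)=0$ for all $v\in\mathcal Z_{\rm gfem}$. Enrichment procedure. Start from $\mathcal Z=\mathcal Z_0$. For $\ell=0,1,2,\dots$: (1) let $\widehat u_\ell$ be the reduced solution associated with the current $\mathcal Z$; (2) choose $k\in\arg\max_{i=1,\dots,N_{\rm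 dd}}r^{(i)}[\widehat u_\ell]$; (3) let $u_k^{\rm loc}\in\mathcal X_{k,0}$ be such that $\mathcal G(\widehat u_\ell+u_k^{\rm loc},v)=0$ for all $v\in\mathcal X_{k,0}$; (4) set $u^\star=u_k^{\rm loc}/\phi_k$ on $\omega_k$ and replace $\mathcal Z$ by $\mathcal Z+{\rm span}\{u^\star\circ\Phi_k\}$. The function $u^\star$ need not be well defined on $\partial\omega_k$; only the products with the partition-of-unity functions are used, so that $\phi_k u^\star=u_k^{\rm loc}$.
   Formalization: The bilinear form a is assumed symmetric in addition to coercive; without symmetry the claimed error bound is false, since adding a large skew part to a can make the energy error grow after one enrichment step. *)

(* Defs.v *)
From HB Require Import structures.
From mathcomp Require Import all_boot all_order all_algebra.
From mathcomp Require Import all_classical all_reals all_analysis.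

Set Implicit Arguments.
Unset Strict Implicit.
Unset Printing Implicit Defensive.
Import Order.TTheory GRing.Theory Num.Theory.
Import numFieldNormedType.Exports.

Local Open Scope classical_set_scope.
Local Open Scope ring_scope.

(** * Lebesgue measure on R^(d+1)

    MathComp-Analysis has the Lebesgue measure on the line only. In dimension
    d+1 (so that the dimension is at least 1 and boxes can be empty) it is the
    Caratheodory restriction of the outer measure given by countable covers by
    boxes. *)

Section Lebesgue.
Context {R : realType} {d : nat}.
Local Notation E := 'rV[R]_d.+1.

Definition box (a b : E) : set E :=
  [set x | forall i, a ord0 i < x ord0 i <= b ord0 i].

Definition box_volume (a b : E) : R :=
  \prod_(i < d.+1) Num.max 0 (b ord0 i - a ord0 i).

Local Open Scope ereal_scope.

Definition lebesgue_outer (A : set E) : \bar R :=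
  ereal_inf [set \sum_(k <oo) (box_volume (c k).1 (c k).2)%:E
            | c in [set c : nat -> E * E |
                    A `<=` \bigcup_k box (c k).1 (c k).2]].

Lemma box_volume_ge0 a b : 0 <= (box_volume a b)%:E.
Proof. by rewrite lee_fin prodr_ge0// => i _; rewrite le_max lexx. Qed.
#[local] Hint Resolve box_volume_ge0 : core.

Lemma lebesgue_outer_ge0 A : 0 <= lebesgue_outer A.
Proof.
by apply: le_ereal_inf_tmp => x [c _ <-{x}]; exact: nneseries_ge0.
Qed.

Lemma lebesgue_outer0 : lebesgue_outer set0 = 0.
Proof.
apply/eqP; rewrite eq_le lebesgue_outer_ge0 andbT.
apply: ereal_inf_lbound; exists (fun=> (0%R, 0%R)) => //=.
rewrite eseries0// => i _ _.
by rewrite /box_volume big_ord_recl !mxE subrr maxxx mul0r.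
Qed.

Lemma le_lebesgue_outer : {homo lebesgue_outer : A B / A `<=` B >-> A <= B}.
Proof.
move=> A B AB; apply/ereal_inf_le_tmp => x [c Bc <-{x}].
by exists c => //; exact: subset_trans Bc.
Qed.

Lemma lebesgue_outer_sigma_subadditive : sigma_subadditive lebesgue_outer.
Proof.
move=> A; have [[i ioo]|] := pselect (exists i, lebesgue_outer (A i) = +oo).
  rewrite (eseries_pinfty _ _ ioo) ?leey// => n _.
  by rewrite -ltNye (lt_le_trans _ (lebesgue_outer_ge0 _)).
rewrite -forallNE => Aoo.
suff add2e (e : {posnum R}) : lebesgue_outer (\bigcup_n A n) <=
    \sum_(i <oo) lebesgue_outer (A i) + e%:num%:E.
  by apply/lee_addgt0Pr => _/posnumP[].
rewrite (le_trans _ (epsilon_trick _ _ _))//; last first.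
  by move=> n; exact: lebesgue_outer_ge0.
pose vol (p : E * E) := (box_volume p.1 p.2)%:E.
have vol_ge0 p : 0 <= vol p by exact: box_volume_ge0.
pose P n (c : nat -> E * E) := A n `<=` \bigcup_k box (c k).1 (c k).2 /\
  \sum_(k <oo) vol (c k) <=
    lebesgue_outer (A n) + (e%:num / (2 ^ n.+1)%:R)%:E.
have [G PG] : {G : nat -> nat -> E * E & forall n, P n (G n)}.
  apply: (@choice _ _ P) => n; rewrite /P /lebesgue_outer.
  set S := (X in ereal_inf X); move infS : (ereal_inf S) => iS.
  case: iS infS => [r Sr|Soo|Soo].
  - have en1 : (0 < e%:num / (2 ^ n.+1)%:R)%R by [].
    have /(lb_ereal_inf_adherent en1) : ereal_inf S \is a fin_num by rewrite Sr.
    move=> [x [c Ac cx] xS].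
    by exists c; split => //; rewrite /vol cx -Sr; exact/ltW.
  - by have := Aoo n; rewrite /lebesgue_outer Soo.
  - suff : lbound S 0 by move/le_ereal_inf_tmp; rewrite Soo.
    by move=> /= _ [c Ac <-]; exact: nneseries_ge0.
have volG_ge0 x : 0 <= (vol \o uncurry G) x by exact: vol_ge0.
apply: (@le_trans _ _ (\esum_(i in setT) (vol \o uncurry G) i)).
  apply: ereal_inf_lbound => /=.
  have /card_esym/ppcard_eqP[f] := card_nat2.
  exists (uncurry G \o f) => /=.
    apply: (@subset_trans _
        (\bigcup_n \bigcup_k box (G n k).1 (G n k).2)) => [t [i _]|].
      by move=> /(PG i).1 -[j _ ?]; exists i => //; exists j.
    move=> t [i _ [j _ Bijt]]; exists (f^-1%FUN (i, j)) => //=.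
    by rewrite invK ?inE.
  rewrite -/(vol _) -(esum_pred_image (vol \o uncurry G) _ xpredT) ?[fun=> _]set_true//.
  by rewrite image_eq.
rewrite (_ : esum _ _ = \sum_(i <oo) \sum_(j <oo) vol (G i j)); last first.
  pose J : nat -> set (nat * nat) := fun i => [set (i, j) | j in setT].
  rewrite (_ : setT = \bigcup_k J k); last first.
    by rewrite predeqE => -[a b]; split => // _; exists a => //; exists b.
  rewrite esum_bigcupT /=; last 2 first.
    - apply/trivIsetP => i j _ _ ij.
      rewrite predeqE => -[n m] /=; split => //= -[] [_] _ [<-{n} _].
      by move=> [m' _] [] /esym/eqP; rewrite (negbTE ij).
    - by move=> /= [n m]; exact: vol_ge0.
  rewrite -(image_id [set: nat]) -fun_true esum_pred_image//; last first.
    by move=> n _; exact: esum_ge0.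
  apply: eq_eseriesr => /= j _.
  rewrite -(esum_pred_image (vol \o uncurry G) (pair j) predT)//=; last first.
    by move=> ? ? _ _; exact: (@can_inj _ _ _ snd).
  by congr esum; rewrite predeqE => -[a b]; split; move=> [i _ <-]; exists i.
apply: lee_lim.
- apply: is_cvg_nneseries => n *.
  by apply: nneseries_ge0 => m *; exact: (volG_ge0 (n, m)).
- by apply: is_cvg_nneseries => n *; apply: adde_ge0 => //;
    exact: lebesgue_outer_ge0.
- by near=> n; apply: lee_sum => i _; exact: (PG i).2.
Unshelve. all: by end_near. Qed.

HB.instance Definition _ := isOuterMeasure.Build R E lebesgue_outer
  lebesgue_outer0 lebesgue_outer_ge0 le_lebesgue_outer
  lebesgue_outer_sigma_subadditive.

(** [Rd] is the type of row vectors with the Lebesgue measurable sets. *)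
Definition Rd := caratheodory_type
  (lebesgue_outer : {outer_measure set E -> \bar R}).

Definition leb : {measure set Rd -> \bar R} :=
  (lebesgue_outer : {outer_measure set E -> \bar R}) : set Rd -> \bar R.

End Lebesgue.

(** * Sobolev spaces

    Functions on a subset of R^(d+1) are represented by total functions; only
    their values on the subset matter, and elements of Lebesgue and Sobolev
    spaces matter only up to equality almost everywhere. *)

Section Sobolev.
Context {R : realType} {d : nat}.
Local Notation E := 'rV[R]_d.+1.
Implicit Types (U : set E) (u v psi : E -> R) (g : 'I_d.+1 -> E -> R).

Definition domain U := [/\ open U, connected U & U !=set0].

Definition partial (j : 'I_d.+1) u : E -> R :=
  fun x => 'D_(delta_mx ord0 j) u x.

Definition smooth u := forall s : seq 'I_d.+1,
  let h := foldr partial u s in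
  continuous h /\ forall j x, derivable h x (delta_mx ord0 j).

Definition test_function U psi :=
  smooth psi /\ exists K : set E,
    [/\ compact K, K `<=` U & forall x, ~ K x -> psi x = 0].

Definition locally_integrable_on U u :=
  forall K : set E, compact K -> K `<=` U -> leb.-integrable K (EFin \o u).

Definition weak_gradient U u g :=
  [/\ locally_integrable_on U u, forall j, locally_integrable_on U (g j) &
      forall j psi, test_function U psi ->
        \int[leb]_(x in U) (u x * partial j psi x) =
        - \int[leb]_(x in U) (g j x * psi x)].

Definition L2 U u :=
  measurable_fun (U : set Rd) (u : Rd -> R) /\
  (\int[leb]_(x in U) (u x ^+ 2)%:E < +oo)%E.

Definition H1 U u :=
  L2 U u /\ exists2 g, weak_gradient U u g & forall j, L2 U (g j).

Definition H10 U u :=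
  L2 U u /\ exists2 g, weak_gradient U u g & (forall j, L2 U (g j)) /\
  exists psi : nat -> E -> R,
    [/\ forall n, test_function U (psi n),
        (fun n => \int[leb]_(x in U) ((u x - psi n x) ^+ 2)%:E)%E @ \oo --> 0%E
      & forall j, (fun n =>
          \int[leb]_(x in U) ((g j x - partial j (psi n) x) ^+ 2)%:E)%E
          @ \oo --> 0%E].

End Sobolev.

(** * The variational problem

    [X] is a set of functions closed under equality almost everywhere in
    [Omega], standing for the space of their classes. *)

Section Problem.
Context {R : realType} {d : nat}.
Local Notation E := 'rV[R]_d.+1.
Local Notation fn := (E -> R).
Variables (Omega : set E) (X : set fn).
Implicit Types (u v w : fn) (ip a : fn -> fn -> R) (f : fn -> R).

Definition bilinear_on a :=
  (forall c u v w, X u -> X v -> X w ->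
     a (c *: u + v) w = c * a u w + a v w) /\
  (forall c u v w, X u -> X v -> X w ->
     a w (c *: u + v) = c * a w u + a w v).

Definition linear_on f :=
  forall c u v, X u -> X v -> f (c *: u + v) = c * f u + f v.

Definition symmetric_on a := forall u v, X u -> X v -> a u v = a v u.

(** The form only depends on the classes of its arguments. *)
Definition ae_compatible a :=
  forall u u' v v', X u -> X u' -> X v -> X v' ->
    u = u' %[ae leb in Omega] -> v = v' %[ae leb in Omega] -> a u v = a u' v'.

(** The norm of a form; for the form [a] of the problem, the energy norm. *)
Definition form_norm a w : R := Num.sqrt (a w w).

(** The scalar product [ip] is not required to be that of [H1 Omega]. *)
Record hilbert_space ip : Prop := {
  hilbert0 : X 0 ;
  hilbertP : forall c u v, X u -> X v -> X (c *: u + v) ;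
  hilbert_ae : forall u v, X u -> u = v %[ae leb in Omega] -> X v ;
  hilbert_bilinear : bilinear_on ip ;
  hilbert_symmetric : symmetric_on ip ;
  hilbert_ge0 : forall u, X u -> 0 <= ip u u ;
  hilbert_eq0 : forall u, X u ->
    ip u u = 0 <-> u = 0 %[ae leb in Omega] ;
  hilbert_complete : forall s : nat -> fn, (forall n, X (s n)) ->
    (forall e : R, 0 < e -> exists M, forall m n, (M <= m)%N -> (M <= n)%N ->
       form_norm ip (s m - s n) < e) ->
    exists2 l, X l & (fun n => form_norm ip (s n - l)) @ \oo --> 0
}.

(** Bilinear, symmetric (so that [form_norm a] is an energy norm) and coercive
    with respect to the norm of [X]. *)
Definition coercive_form ip a :=
  [/\ bilinear_on a, ae_compatible a, symmetric_on a &
      exists2 alpha : R, 0 < alpha &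
        forall v, X v -> alpha * form_norm ip v ^+ 2 <= a v v].

Definition dual_element ip f :=
  linear_on f /\
  exists C : R, forall v, X v -> `|f v| <= C * form_norm ip v.

Definition calG f a w v : R := f v - a w v.

(** The supremum of [F v / ||v||_a] over the nonzero [v] of [Y].  It is a real
    supremum: where it is used, the quotients are bounded by the
    Cauchy-Schwarz inequality. *)
Definition dual_norm a (Y : set fn) (F : fn -> R) : R :=
  sup [set F v / form_norm a v
      | v in [set v | Y v /\ ~ (v = 0 %[ae leb in Omega])]].

End Problem.

(** * Overlapping decomposition and partition of unity *)

(** The map of component [i] is [x |-> x *m rot i + shift i]. *)
Record decomposition (R : realType) (d N : nat) := Decomposition {
  archetype : set 'rV[R]_d.+1 ;
  rot : 'I_N -> 'M[R]_d.+1 ;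
  shift : 'I_N -> 'rV[R]_d.+1 ;
  pou : 'I_N -> 'rV[R]_d.+1 -> R
}.

Section Decomposition.
Context {R : realType} {d N : nat}.
Local Notation E := 'rV[R]_d.+1.
Local Notation fn := (E -> R).
Variable D : decomposition R d N.

Definition Phi (i : 'I_N) (x : E) : E := x *m rot D i + shift D i.

Definition Phi_inv (i : 'I_N) (y : E) : E := (y - shift D i) *m invmx (rot D i).

Definition omega (i : 'I_N) : set E := Phi i @` archetype D.

(** The components are open and [Omega] is connected, so that a cover by more
    than one nonempty component automatically has overlaps. *)
Record is_decomposition (Omega : set E) : Prop := {
  archetype_open : open (archetype D) ;
  rot_orthogonal : forall i, rot D i *m (rot D i)^T = 1%:M ;
  rot_det : forall i, \det (rot D i) = 1 ;
  omega_cover : \bigcup_i omega i = Omega ;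
  pou_supp : forall i,
    closure [set x | Omega x /\ pou D i x != 0] `<=` closure (omega i) ;
  pou_itv : forall i x, Omega x -> 0 <= pou D i x <= 1 ;
  pou_grad : forall i, exists C : R, exists2 g : 'I_d.+1 -> fn,
    weak_gradient Omega (pou D i) g &
    {ae leb, forall x, Omega x -> Num.sqrt (\sum_j g j x ^+ 2) <= C} ;
  pou_sum : forall x, Omega x -> \sum_(i < N) pou D i x = 1
}.

Variables (Omega : set E) (X : set fn) (f : fn -> R) (a : fn -> fn -> R).
Implicit Types (Z : set fn) (w : fn).

(** [H10 (omega i)], extended by zero in [Omega] and regarded as a part of
    [X]. *)
Definition local_space (i : 'I_N) : set fn :=
  [set v | [/\ X v, H10 (omega i) v &
               v = 0 %[ae leb in Omega `\` omega i]]].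

Definition local_residual (i : 'I_N) w : R :=
  dual_norm Omega a (local_space i) (calG f a w).

Definition finite_dimensional Z :=
  exists n (b : 'I_n -> fn),
    Z = [set z | exists c : 'I_n -> R, z = \sum_(i < n) c i *: b i].

Definition gfem Z : set fn :=
  [set w | exists2 zeta : 'I_N -> fn, forall i, Z (zeta i) &
     w = (fun x => \sum_(i < N)
            patch (fun=> 0) (omega i) (pou D i \* (zeta i \o Phi_inv i)) x)
       %[ae leb in Omega]].

Definition reduced_space Z := finite_dimensional Z /\ gfem Z `<=` X.

Definition reduced_solution Z w :=
  gfem Z w /\ forall v, gfem Z v -> calG f a w v = 0.

(** [ustar] is the quotient of [uloc] by [pou D k]. Where [pou D k] vanishes
    in [omega k], its value is free, but the product must still be [uloc]. *)
Definition enrichment_step Z w Z' :=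
  exists k : 'I_N, exists uloc ustar : fn,
  [/\ forall i, local_residual i w <= local_residual k w,
      local_space k uloc /\
        forall v, local_space k v -> calG f a (w + uloc) v = 0,
      {ae leb, forall x, omega k x -> pou D k x != 0 ->
         ustar x = uloc x / pou D k x},
      {ae leb, forall x, omega k x -> pou D k x * ustar x = uloc x} &
      Z' = [set z | exists2 z0, Z z0 &
             exists c : R, z = z0 + c *: (ustar \o Phi k)]].

Definition enrichment_sequence Z0 (Z : nat -> set fn) (uhat : nat -> fn) :=
  Z 0%N = Z0 /\ forall l,
    [/\ reduced_space (Z l), reduced_solution (Z l) (uhat l) &
        enrichment_step (Z l) (uhat l) (Z l.+1)].

End Decomposition.

(* Main.v *)
(** Put [e_l = u - uhat_l], so that the residual of [uhat_l] is [a(e_l, .)].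
    The local correction [uloc] is the [a]-orthogonal projection of [e_l] onto
    the space of the selected component, hence the largest local residual is at
    most [||uloc||_a], and [cpuP] gives
    [||e_l||_a ^ 2 <= N cpu^2 ||uloc||_a ^ 2].  The enriched space contains
    [uhat_l + uloc], up to a null set, so that optimality of the Galerkin
    solution gives
    [||e_(l+1)||_a ^ 2 <= ||e_l||_a ^ 2 - ||uloc||_a ^ 2
                       <= (1 - 1/(N cpu^2)) ||e_l||_a ^ 2].  Squaring the
    residuals requires them to be nonnegative, for which the local spaces have
    to be closed under negation. *)
Require Import Defs.
From mathcomp Require Import all_boot all_order all_algebra.
From mathcomp Require Import all_classical all_reals all_analysis.
From mathcomp Require Import ring lra.

Set Implicit Arguments.
Unset Strict Implicit.
Unset Printing Implicit Defensive.
Import Order.TTheory GRing.Theory Num.Theory.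
Import numFieldNormedType.Exports.
Local Open Scope classical_set_scope.
Local Open Scope ring_scope.

(** * Cauchy-Schwarz and best approximation for nonnegative symmetric forms *)

Lemma discriminant_le (R : realType) (p q r : R) :
  0 <= r -> (forall t, 0 <= p + 2 * t * q + t ^+ 2 * r) -> q ^+ 2 <= p * r.
Proof.
move=> r_ge0 pqr; have [r0|r0] := eqVneq r 0.
  have [->|q0] := eqVneq q 0; first by rewrite r0 mulr0 expr0n.
  (* With [r = 0] the expression is affine in [t], and this [t] gives it the value [-1]. *)
  have := pqr (- (p + 1) / (2 * q)); rewrite r0 mulr0 addr0.
  have -> : 2 * (- (p + 1) / (2 * q)) * q = - (p + 1) by field.
  by move=> ?; exfalso; lra.
have r_gt0 : 0 < r by rewrite lt_neqAle eq_sym r0.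
(* The minimiser of the quadratic. *)
have := pqr (- q / r).
have -> : p + 2 * (- q / r) * q + (- q / r) ^+ 2 * r = (p * r - q ^+ 2) / r.
  by field.
by rewrite pmulr_lge0 ?invr_gt0// subr_ge0.
Qed.

Section PositiveForm.
Context {R : realType} {d : nat}.
Local Notation fn := ('rV[R]_d.+1 -> R).
Variables (X : set fn) (a : fn -> fn -> R).
Hypotheses (X0 : X 0) (XP : forall c u v, X u -> X v -> X (c *: u + v)).
Hypotheses (aP : bilinear_on X a) (aC : symmetric_on X a).
Hypothesis a_ge0 : forall v, X v -> 0 <= a v v.

Lemma form0r v : X v -> a v 0 = 0.
Proof.
move=> Xv; have := aP.2 1 0 0 v X0 X0 Xv.
by rewrite scaler0 addr0 mul1r => /eqP; rewrite -subr_eq subrr eq_sym => /eqP.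
Qed.

Lemma memD u v : X u -> X v -> X (u + v).
Proof. by move=> Xu Xv; have := XP 1 Xu Xv; rewrite scale1r. Qed.

Lemma memN v : X v -> X (- v).
Proof. by move=> Xv; have := XP (-1) Xv X0; rewrite scaleN1r addr0. Qed.

Lemma memB u v : X u -> X v -> X (u - v).
Proof. by move=> Xu Xv; apply: memD => //; exact: memN. Qed.

Lemma formDl u v w : X u -> X v -> X w -> a (u + v) w = a u w + a v w.
Proof.
by move=> Xu Xv Xw; have := aP.1 1 _ _ _ Xu Xv Xw; rewrite scale1r mul1r.
Qed.

Lemma formNr w v : X v -> X w -> a w (- v) = - a w v.
Proof.
move=> Xv Xw; have := aP.2 (-1) _ _ _ Xv X0 Xw.
by rewrite form0r// !addr0 scaleN1r mulN1r.
Qed.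

Lemma formNl w v : X v -> X w -> a (- v) w = - a v w.
Proof.
by move=> Xv Xw; rewrite aC ?formNr//; [rewrite aC|exact: memN].
Qed.

Lemma formDr w u v : X u -> X v -> X w -> a w (u + v) = a w u + a w v.
Proof.
by move=> Xu Xv Xw; have := aP.2 1 _ _ _ Xu Xv Xw; rewrite scale1r mul1r.
Qed.

Lemma formBl u v w : X u -> X v -> X w -> a (u - v) w = a u w - a v w.
Proof. by move=> Xu Xv Xw; rewrite formDl ?formNl//; exact: memN. Qed.

Lemma formBr w u v : X u -> X v -> X w -> a w (u - v) = a w u - a w v.
Proof. by move=> Xu Xv Xw; rewrite formDr ?formNr//; exact: memN. Qed.

(** The quadratic fed to [discriminant_le] is [t |-> a (t *: v + u) (t *: v + u)]. *)
Lemma form_CS u v : X u -> X v -> a u v ^+ 2 <= a u u * a v v.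
Proof.
move=> Xu Xv; apply: discriminant_le => [|t]; first exact: a_ge0.
have Xw := XP t Xv Xu; have := a_ge0 Xw.
rewrite (aP.1 t)// !(aP.2 t)// (aC Xv Xu).
by congr (0 <= _); ring.
Qed.

Lemma form_norm_ge0 v : 0 <= form_norm a v.
Proof. exact: sqrtr_ge0. Qed.

Lemma sqr_form_norm v : X v -> form_norm a v ^+ 2 = a v v.
Proof. by move=> Xv; rewrite sqr_sqrtr// a_ge0. Qed.

Lemma form_le_norm u v : X u -> X v ->
  `|a u v| <= form_norm a u * form_norm a v.
Proof.
move=> Xu Xv; rewrite -sqrtr_sqr /form_norm -sqrtrM ?a_ge0//.
by rewrite ler_wsqrtr// form_CS.
Qed.

(* Both [v] and [w] are orthogonal to [u - v], which gives
   [a (u - v) (u - v) = a (u - v) (u - w)]. *)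
Lemma galerkin_le u v w : X u -> X v -> X w ->
  a (u - v) v = 0 -> a (u - v) w = 0 -> a (u - v) (u - v) <= a (u - w) (u - w).
Proof.
move=> Xu Xv Xw ev ew; have Xe := memB Xu Xv; have Xe' := memB Xu Xw.
have /eqP : a (u - v) (u - v) = a (u - v) (u - w).
  by rewrite !(formBr Xu)// ev ew.
rewrite eq_le => /andP[+ _].
have := form_CS Xe Xe'; have := a_ge0 Xe; have := a_ge0 Xe'.
have -> : a (u - v) (u - w) = a (u - v) (u - v) by rewrite !(formBr Xu)// ev ew.
(* Cauchy-Schwarz now reads [x * x <= x * y] for the two energies: a positive [x] cancels, and
   [x = 0] is trivial since [0 <= y]. *)
rewrite expr2; case: (ltgtP 0 (a (u - v) (u - v))) => // [e_gt0|<-//] _ _ + _.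
by rewrite ler_pM2l.
Qed.

End PositiveForm.

(** * The dual norm as a real supremum *)

Section DualNorm.
Context {R : realType} {d : nat}.
Local Notation fn := ('rV[R]_d.+1 -> R).
Variables (Omega : set 'rV[R]_d.+1) (a : fn -> fn -> R) (Y : set fn).
Variables (F : fn -> R) (C : R).
Hypothesis a_gt0 : forall v, Y v -> ~ (v = 0 %[ae leb in Omega]) ->
  0 < form_norm a v.
Hypothesis FC : forall v, Y v -> `|F v| <= C * form_norm a v.

Let quotient_le v : Y v -> ~ (v = 0 %[ae leb in Omega]) ->
  `|F v / form_norm a v| <= C.
Proof.
move=> Yv v0; have av := a_gt0 Yv v0.
by rewrite normrM normfV (gtr0_norm av) ler_pdivrMr// FC.
Qed.

(** [FC] bounds the quotients; for an unbounded set [sup] would be the default value [0]. *)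
Lemma dual_norm_ubound v : Y v -> ~ (v = 0 %[ae leb in Omega]) ->
  F v / form_norm a v <= dual_norm Omega a Y F.
Proof.
move=> Yv v0; apply: ub_le_sup; last by exists v.
exists C => _ [w [Yw w0] <-].
exact: le_trans (ler_norm _) (quotient_le Yw w0).
Qed.

Lemma dual_norm_le : 0 <= C -> dual_norm Omega a Y F <= C.
Proof.
move=> C_ge0; rewrite /dual_norm; set S := (X in sup X).
have [[s Ss]|S0] := pselect (S !=set0); last first.
  (* The supremum of the empty set is [0], whence the hypothesis [0 <= C]. *)
  by move/nonemptyPn : S0 => ->; rewrite sup0.
apply: ge_sup; first by exists s.
by move=> _ [w [Yw w0] <-]; exact: le_trans (ler_norm _) (quotient_le Yw w0).
Qed.

(** [F] is nonnegative at [v] or at [- v], and the supremum dominates both quotients; if there is no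
    nonzero [v], it is [0]. *)
Lemma dual_norm_ge0 : (forall v, Y v -> Y (- v)) ->
  (forall v, Y v -> F (- v) = - F v) -> 0 <= dual_norm Omega a Y F.
Proof.
move=> YN FN; rewrite /dual_norm.
have [[v [Yv v0]]|S0] :=
    pselect ([set v | Y v /\ ~ (v = 0 %[ae leb in Omega])] !=set0); last first.
  by move/nonemptyPn : S0 => ->; rewrite image_set0 sup0.
have [Fv|Fv] := leP 0 (F v).
  apply: le_trans (dual_norm_ubound Yv v0).
  by rewrite divr_ge0// ltW// a_gt0.
have v0' : ~ (- v = 0 %[ae leb in Omega]).
  move=> vN0; apply: v0; move: vN0.
  apply: (@filterS _ _ (ae_filter_ringOfSetsType leb)) => x + Ox.
  by move=> /(_ Ox)/eqP; rewrite oppr_eq0 => /eqP.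
apply: le_trans (dual_norm_ubound (YN _ Yv) v0').
by rewrite divr_ge0 ?FN ?oppr_ge0 ?ltW// a_gt0// ; exact: YN.
Qed.

End DualNorm.

(** * Closure of [H10] under negation *)

Section Negation.
Context {R : realType} {d : nat}.
Local Notation E := 'rV[R]_d.+1.
Implicit Types (U : set E) (u psi : E -> R).

Lemma partialN j u : (forall x, derivable u x (delta_mx ord0 j)) ->
  partial j (- u) = - partial j u.
Proof. by move=> du; apply/funext => x; rewrite /partial deriveN. Qed.

Lemma smooth_foldr_partialN psi s : smooth psi ->
  foldr partial (- psi) s = - foldr partial psi s.
Proof.
move=> sm; elim: s => //= j s ->; apply: partialN => x.
exact: (sm s).2.
Qed.

Lemma smoothN psi : smooth psi -> smooth (- psi).
Proof.
move=> sm s; have [cs ds] := sm s; rewrite /= smooth_foldr_partialN//; split.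
  by move=> x; apply: continuousN; exact: cs.
by move=> j x; apply: derivableN; exact: ds.
Qed.

Lemma test_functionN U psi : test_function U psi -> test_function U (- psi).
Proof.
move=> [sm [K [cK KU K0]]]; split; first exact: smoothN.
by exists K; split => // x /K0 psi0; rewrite fctE psi0 oppr0.
Qed.

Lemma test_partialN U psi j : test_function U psi ->
  partial j (- psi) = - partial j psi.
Proof. by move=> [sm _]; apply: partialN => x; exact: (sm [::]).2. Qed.

Lemma L2N U u : L2 U u -> L2 U (- u).
Proof.
move=> [mu iu]; split; first exact: measurable_realfun.measurable_funN.
by under eq_integral do rewrite fctE sqrrN.
Qed.

Lemma locally_integrable_onN U u :
  locally_integrable_on U u -> locally_integrable_on U (- u).
Proof. by move=> iu K cK KU; have := integrableN (iu K cK KU). Qed.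

(* The sign is moved to the test function: pulling it out of the integrals would
   require integrability, since [Rintegral] is [0] when the integral is not
   finite. *)
Lemma weak_gradientN U u g :
  weak_gradient U u g -> weak_gradient U (- u) (fun j => - g j).
Proof.
move=> [iu ig ug]; split; first exact: locally_integrable_onN.
  by move=> j; exact: locally_integrable_onN.
move=> j psi Tpsi; have := ug j _ (test_functionN Tpsi).
rewrite (test_partialN _ Tpsi).
under eq_Rintegral do rewrite fctE mulrN -mulNr.
by under [X in _ = - X]eq_Rintegral do rewrite fctE mulrN -mulNr.
Qed.

Lemma H10N U u : H10 U u -> H10 U (- u).
Proof.
move=> [L2u [g ug [L2g [psi [Tpsi psiu psig]]]]]; split; first exact: L2N.
exists (fun j => - g j); first exact: weak_gradientN.
split=> [j|]; first exact: L2N.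
(* Negating the approximating functions as well leaves the squared differences unchanged. *)
exists (fun n => - psi n); split => [n||j].
- exact: test_functionN.
- under eq_fun do under eq_integral do rewrite !fctE -opprD sqrrN.
  exact: psiu.
- under eq_fun => n do
    (rewrite (test_partialN _ (Tpsi n));
     under eq_integral do rewrite !fctE -opprD sqrrN).
  exact: psig.
Qed.

End Negation.

(** * The enriched space and the contraction in one step *)

Lemma Phi_invK (R : realType) (d N : nat) (D : decomposition R d N) Omega i :
  is_decomposition D Omega -> cancel (Phi_inv D i) (Phi D i).
Proof.
move=> DP y; rewrite /Phi /Phi_inv -mulmxA mulVmx ?mulmx1 ?subrK//.
by rewrite unitmxE (rot_det DP) unitr1.
Qed.

Section Enrichment.
Context {R : realType} {d N : nat}.
Local Notation E := 'rV[R]_d.+1.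
Local Notation fn := (E -> R).
Variables (D : decomposition R d N) (Omega : set E) (X : set fn).
Variables (ip a : fn -> fn -> R) (f : fn -> R) (cpu : R) (u : fn).
Hypotheses (X_hilbert : hilbert_space Omega X ip)
  (a_coercive : coercive_form Omega X ip a)
  (D_decomposition : is_decomposition D Omega).

Lemma local_spaceN i v :
  local_space D Omega X i v -> local_space D Omega X i (- v).
Proof.
move=> [Xv Hv v0]; split.
- exact: (memN (hilbert0 X_hilbert) (hilbertP X_hilbert)).
- exact: H10N.
- move: v0; apply: (@filterS _ _ (ae_filter_ringOfSetsType leb)) => x + Ox.
  by rewrite fctE => /(_ Ox) ->; rewrite oppr0.
Qed.

(** Provides the competitor for the next Galerkin solution. Only the coefficient of component [k]
    changes: its extra term is [uloc] on [omega D k], while outside both the patched term and [uloc]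
    vanish almost everywhere in [Omega]. *)
Lemma gfem_enrichment Z w k uloc ustar Z' :
  gfem D Omega Z w ->
  local_space D Omega X k uloc ->
  {ae leb, forall x, omega D k x -> pou D k x * ustar x = uloc x} ->
  Z' = [set z | exists2 z0, Z z0 &
          exists c : R, z = z0 + c *: (ustar \o Phi D k)] ->
  gfem D Omega Z' (w + uloc).
Proof.
move=> [zeta Zzeta wE] [_ _ uloc0] ustarE ->.
exists (fun i => zeta i + (i == k)%:R *: (ustar \o Phi D k)) => [i|].
  by exists (zeta i) => //; exists (i == k)%:R.
move: ustarE uloc0 wE; apply: (@filterS3 _ _ (ae_filter_ringOfSetsType leb)).
move=> x ux u0 wx Ox.
rewrite fctE wx//.
under [RHS]eq_bigr => i _.
  have -> : patch (fun=> 0) (omega D i) (pou D i \* ((zeta i +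
      (i == k)%:R *: (ustar \o Phi D k)) \o Phi_inv D i)) x =
    patch (fun=> 0) (omega D i) (pou D i \* (zeta i \o Phi_inv D i)) x +
    (if i == k then uloc x else 0).
    rewrite !patchE; have [xi|xi] := boolP (x \in omega D i).
    - rewrite /= !fctE /= mulrDr; congr +%R; case: eqP => [ik|_].
        rewrite ik scale1r /= (Phi_invK _ D_decomposition) ux//.
        by move: xi; rewrite ik inE.
      by rewrite scale0r mulr0.
    - case: eqP => [ik|_]; last by rewrite addr0.
      rewrite add0r u0//; split => //.
      by move: xi; rewrite ik notin_setE.
  over.
by rewrite big_split/= -[X in _ = _ + X]big_mkcond big_pred1_eq.
Qed.

Let X0 := hilbert0 X_hilbert.
Let XP := hilbertP X_hilbert.

Lemma coercive_ge0 v : X v -> 0 <= a v v.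
Proof.
move=> Xv; have [_ _ _ [al al0 alP]] := a_coercive.
by apply: le_trans (alP _ Xv); rewrite mulr_ge0 ?sqr_ge0// ltW.
Qed.

(** Coercivity transfers definiteness from [ip] to [a]; conversely, [a] depends only on classes of
    functions. *)
Lemma coercive_eq0 v : X v -> a v v = 0 <-> v = 0 %[ae leb in Omega].
Proof.
move=> Xv; have [aP aae aC [al al0 alP]] := a_coercive; split=> [av0|v0].
  apply/(hilbert_eq0 X_hilbert Xv)/eqP; rewrite eq_le (hilbert_ge0 X_hilbert)//.
  rewrite andbT -(pmulr_rle0 _ al0).
  by have := alP _ Xv; rewrite sqr_sqrtr ?(hilbert_ge0 X_hilbert)// av0.
rewrite (aae v 0 v 0)//; exact: (form0r X0 aP).
Qed.

Lemma coercive_gt0 v : X v -> ~ (v = 0 %[ae leb in Omega]) ->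
  0 < form_norm a v.
Proof.
move=> Xv v0; rewrite sqrtr_gt0 lt_neqAle coercive_ge0// andbT eq_sym.
by apply/eqP => /(coercive_eq0 Xv).
Qed.

Hypotheses (cpu_gt0 : 0 < cpu)
  (cpuP : forall w, X w -> dual_norm Omega a X (calG f a w) <=
     cpu * Num.sqrt (\sum_(i < N) local_residual D Omega X f a i w ^+ 2)).
Hypotheses (u_X : X u) (u_solution : forall v, X v -> a u v = f v).

Let aP : bilinear_on X a. Proof. by case: a_coercive. Qed.
Let aC : symmetric_on X a. Proof. by case: a_coercive. Qed.

Lemma calG_error w v : X w -> X v -> calG f a w v = a (u - w) v.
Proof. by move=> Xw Xv; rewrite /calG -u_solution// (formBl X0 XP aP aC). Qed.

(** The quotient at the test function [u - w] is the energy norm of the error itself. *)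
Lemma error_le_dual_norm w : X w ->
  form_norm a (u - w) <= dual_norm Omega a X (calG f a w).
Proof.
move=> Xw; have Xe := memB X0 XP u_X Xw.
have bound v : X v -> `|calG f a w v| <= form_norm a (u - w) * form_norm a v.
  move=> Xv; rewrite calG_error//; exact: (form_le_norm XP aP aC coercive_ge0).
(* A null error is not an admissible test function; the left side is then [0]. *)
have [e0|e0] := pselect (u - w = 0 %[ae leb in Omega]).
  rewrite {1}/form_norm (coercive_eq0 Xe).2// sqrtr0.
  apply: (dual_norm_ge0 coercive_gt0 bound) => v Xv.
    exact: (memN X0 XP).
  by rewrite !calG_error ?(formNr X0 aP)//; exact: (memN X0 XP).
apply: le_trans (dual_norm_ubound coercive_gt0 bound Xe e0).
rewrite calG_error// -(sqr_form_norm coercive_ge0)// expr2 mulfK//.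
by rewrite gt_eqF// coercive_gt0.
Qed.

Lemma enrichment_contraction Z w Z' w' :
  reduced_space D Omega X Z -> reduced_solution D Omega f a Z w ->
  enrichment_step D Omega X f a Z w Z' ->
  reduced_space D Omega X Z' -> reduced_solution D Omega f a Z' w' ->
  a (u - w') (u - w') <= (1 - (N%:R * cpu ^+ 2)^-1) * a (u - w) (u - w).
Proof.
move=> [_ ZX] [gw _] [k [uloc [ustar [kmax [lu uG] _ ustarE Z'E]]]] [_ Z'X].
move=> [gw' w'G].
have gwu := gfem_enrichment gw lu ustarE Z'E.
have Xw := ZX _ gw; have Xw' := Z'X _ gw'; have Xwu := Z'X _ gwu.
have Xl : X uloc by case: lu.
have Xe := memB X0 XP u_X Xw.
have eE v : local_space D Omega X k v -> a (u - w) v = a uloc v.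
  move=> lv; have Xv : X v by case: lv.
  have := uG _ lv; rewrite calG_error// opprD addrA.
  rewrite (formBl X0 XP aP aC Xe)//.
  by move/eqP; rewrite subr_eq0 => /eqP.
have best : a (u - w') (u - w') <= a (u - w) (u - w) - a uloc uloc.
  have := galerkin_le X0 XP aP aC coercive_ge0 u_X Xw' Xwu.
  rewrite -(calG_error Xw' Xw') -(calG_error Xw' Xwu) !w'G//.
  move=> /(_ erefl erefl)/le_trans; apply.
  (* Pythagoras: by symmetry and [eE] at [uloc], both cross terms equal [a uloc uloc]. *)
  rewrite opprD addrA (formBr X0 XP aP Xe Xl (memB X0 XP Xe Xl)).
  rewrite !(formBl X0 XP aP aC Xe Xl)// (aC Xl Xe) (eE _ lu).
  by rewrite subrr subr0.
have l_ge0 := form_norm_ge0 a uloc.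
have res_ge0 i : 0 <= local_residual D Omega X f a i w.
  have lX v : local_space D Omega X i v -> X v by case.
  apply: (@dual_norm_ge0 _ _ _ _ _ _ (form_norm a (u - w))) => v lv.
  - exact/coercive_gt0/lX.
  - rewrite calG_error//; last exact: lX.
    exact: (form_le_norm XP aP aC coercive_ge0 Xe (lX _ lv)).
  - exact: local_spaceN.
  - have Xv := lX _ lv; rewrite !calG_error ?(formNr X0 aP)//.
    exact: (memN X0 XP).
have res_le : local_residual D Omega X f a k w <= form_norm a uloc.
  apply: dual_norm_le => // v lv; have Xv : X v by case: lv.
    exact: coercive_gt0.
  (* Replacing the error by its projection makes the Cauchy-Schwarz constant the norm of [uloc]. *)
  rewrite calG_error// eE//.
  exact: (form_le_norm XP aP aC coercive_ge0).
have sum_le : \sum_(i < N) local_residual D Omega X f a i w ^+ 2 <=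
    N%:R * a uloc uloc.
  (* The factor [N] arises here: the greedy choice bounds every residual by that of [k]. *)
  rewrite -[in N%:R](card_ord N) mulr_natl -sumr_const; apply: ler_sum => i _.
  rewrite -(sqr_form_norm coercive_ge0)// ler_sqr ?nnegrE//.
  exact: le_trans (kmax i) res_le.
(* The selected index [k] inhabits ['I_N]. *)
have N_gt0 : 0 < N%:R :> R by rewrite ltr0n; exact: leq_ltn_trans (ltn_ord k).
have c2_gt0 : 0 < N%:R * cpu ^+ 2 by rewrite mulr_gt0// exprn_gt0.
have : a (u - w) (u - w) <= N%:R * cpu ^+ 2 * a uloc uloc.
  rewrite -(sqr_form_norm coercive_ge0)//.
  have sum_ge0 : 0 <= \sum_(i < N) local_residual D Omega X f a i w ^+ 2.
    by apply: sumr_ge0 => i _; exact: sqr_ge0.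
  apply: (@le_trans _ _ ((cpu * Num.sqrt
      (\sum_(i < N) local_residual D Omega X f a i w ^+ 2)) ^+ 2)).
    rewrite ler_sqr ?nnegrE ?form_norm_ge0 ?mulr_ge0 ?sqrtr_ge0 ?(ltW cpu_gt0)//.
    exact: le_trans (error_le_dual_norm Xw) (cpuP Xw).
  rewrite exprMn sqr_sqrtr// [N%:R * _]mulrC -[leRHS]mulrA.
  by rewrite ler_pM2l ?exprn_gt0.
rewrite -ler_pdivrMl// => loc_ge.
by apply: (le_trans best); rewrite mulrBl mul1r lerD2l lerN2.
Qed.

End Enrichment.

(** * Iteration of the contraction *)

Lemma geometric_sqrt (R : realType) (q : R) (b : nat -> R) :
  (forall n, 0 <= b n) -> (forall n, b n.+1 <= q * b n) ->
  forall n, (0 < n)%N ->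
    Num.sqrt (b n) <= q `^ (n%:R / 2) * Num.sqrt (b 0%N).
Proof.
move=> b_ge0 bq n n_gt0.
(* The sign of [q] is not given. A negative [q] forces [b n = 0] for positive [n], and then
   nonnegativity of the right side suffices. *)
have [q_lt0|q_ge0] := ltP q 0.
  have -> : b n = 0.
    case: n n_gt0 => // n _; apply/eqP; rewrite eq_le b_ge0 andbT.
    by apply: le_trans (bq n) _; rewrite nmulr_rle0.
  by rewrite sqrtr0 mulr_ge0 ?powR_ge0 ?sqrtr_ge0.
have bn : b n <= q ^+ n * b 0%N.
  elim: n {n_gt0} => [|n IH]; first by rewrite expr0 mul1r.
  by rewrite exprS -mulrA; apply: le_trans (bq n) _; rewrite ler_wpM2l.
(* The real power with exponent [n%:R / 2] is the square root of [q ^+ n], as [q] is nonnegative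
   here. *)
rewrite powRrM powR_mulrn// powR12_sqrt ?exprn_ge0// -sqrtrM ?exprn_ge0//.
exact: ler_wsqrtr.
Qed.

Theorem proposition5p2 (R : realType) (d N : nat)
    (Omega : set 'rV[R]_d.+1) (X : set ('rV[R]_d.+1 -> R))
    (ip a : ('rV[R]_d.+1 -> R) -> ('rV[R]_d.+1 -> R) -> R)
    (f : ('rV[R]_d.+1 -> R) -> R)
    (D : decomposition R d N) (cpu : R)
    (u : 'rV[R]_d.+1 -> R)
    (Z0 : set ('rV[R]_d.+1 -> R))
    (Z : nat -> set ('rV[R]_d.+1 -> R)) (uhat : nat -> 'rV[R]_d.+1 -> R)
    (Omega_domain : domain Omega)
    (X_hilbert : hilbert_space Omega X ip)
    (H10_X : H10 Omega `<=` X) (X_H1 : X `<=` H1 Omega)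
    (a_coercive : coercive_form Omega X ip a)
    (f_dual : dual_element X ip f)
    (D_decomposition : is_decomposition D Omega)
    (cpu_gt0 : 0 < cpu)
    (cpuP : forall w, X w ->
       dual_norm Omega a X (calG f a w) <=
       cpu * Num.sqrt (\sum_(i < N) local_residual D Omega X f a i w ^+ 2))
    (u_X : X u) (u_solution : forall v, X v -> a u v = f v)
    (Z0_reduced : reduced_space D Omega X Z0)
    (uhat_sequence : enrichment_sequence D Omega X f a Z0 Z uhat) :
  forall l : nat, (1 <= l)%N ->
    form_norm a (u - uhat l) <=
    (1 - (N%:R * cpu ^+ 2)^-1) `^ (l%:R / 2) * form_norm a (u - uhat 0%N).
Proof.
have [Z0E step] := uhat_sequence.
(* The contraction concerns squared energies; [form_norm] is their square root by definition. *)
apply: (geometric_sqrt (b := fun l => a (u - uhat l) (u - uhat l))) => l.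
  have [[_ ZX] [gl _] _] := step l.
  apply: (coercive_ge0 a_coercive).
  exact: (memB (hilbert0 X_hilbert) (hilbertP X_hilbert) u_X (ZX _ gl)).
have [Zl ul el] := step l; have [Zl' ul' _] := step l.+1.
exact: (enrichment_contraction X_hilbert a_coercive D_decomposition cpu_gt0
  cpuP u_X u_solution Zl ul el Zl' ul').
Qed.
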